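(* For $2\le k\le n^{2/3}$ we have $\mathrm{ex}(n,\mathit{St}_4(\sqrt{k},k,1))\approx \max\{k^2n^2,k^{9/2}n\}$.
   Context: For an $r$-graph $\mathcal{F}$, $\mathrm{ex}(n,\mathcal{F})$ is the maximum number of edges in an $n$-vertex $r$-graph with no copy of $\mathcal{F}$. Generalised stars are defined recursively: $\mathit{St}_2(d)$ is the graph star with $d$ leaves, and $\mathit{St}_r(d_1,\dots,d_{r-1})$ is the $r$-graph in which all edges contain a common vertex $v$ and upon removing $v$ from every edge one obtains $d_1$ vertex-disjoint copies of $\mathit{St}_{r-1}(d_2,\dots,d_{r-1})$. Thus $\mathit{St}_4(\sqrt{k},k,1)$ consists of a vertex $v$ together with $\sqrt{k}$ vertex-disjoint $3$-uniform sunflowers, each consisting of $k$ triples sharing exactly one common vertex. Non-integer quantities such as $\sqrt{k}$ are to be rounded (the paper omits floors and ceilings, affecting only constants). $f\approx g$ means $cg\le f\le Cg$ for absolute constants $c,C>0$.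
   Formalization: The formal theorem also assumes n ≥ 4; this excludes only n = 3, k = 2, where there are no 4-edges, so ex = 0 and the lower bound fails. *)

(* Defs.v *)
From HB Require Import structures.
From mathcomp Require Import all_boot all_order all_algebra.

Set Implicit Arguments.
Unset Strict Implicit.
Unset Printing Implicit Defensive.

Record hypergraph := Hypergraph {
  vertex : finType;
  edges : {set {set vertex}}
}.

Definition uniform (r : nat) (T : finType) (E : {set {set T}}) : bool :=
  [forall e in E, #|e| == r].

(* Copies are not required to be induced. *)
Definition has_copy (F : hypergraph) (T : finType) (E : {set {set T}}) : bool :=
  [exists f : {ffun vertex F -> T},
     injectiveb f && [forall e in edges F, f @: e \in E]].

Definition extremal (r n : nat) (F : hypergraph) : nat :=
  \max_(E : {set {set 'I_n}} | uniform r E && ~~ has_copy F E) #|E|.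

Definition star_graph (d : nat) : hypergraph :=
  @Hypergraph (option 'I_d) [set [set None; Some i] | i : 'I_d].

Definition disjoint_copies (d : nat) (F : hypergraph) : hypergraph :=
  @Hypergraph ('I_d * vertex F)%type
    [set [set (i, x) | x in e] | i : 'I_d, e : {set vertex F} in edges F].

Definition add_apex (F : hypergraph) : hypergraph :=
  @Hypergraph (option (vertex F))
    [set None |: [set Some x | x in e] | e : {set vertex F} in edges F].

(* [gen_star d1 [:: d2; ...; d_(r-1)]] is the r-graph St_r(d1, ..., d_(r-1));
   the uniformity r is the length of the tail plus 2. *)
Fixpoint gen_star (d : nat) (ds : seq nat) : hypergraph :=
  if ds is d' :: ds' then add_apex (disjoint_copies d (gen_star d' ds'))
  else star_graph d.

(* [s] is the floor or the ceiling of [x] (and [s = x] if [x] is an integer). *)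
Definition is_rounding (R : numDomainType) (s : nat) (x : R) : Prop :=
  (`|s%:R - x| < 1)%R.

(* Main.v *)
Require Import Defs.
From HB Require Import structures.
From mathcomp Require Import all_classical all_reals all_analysis.
From mathcomp Require Import all_boot all_order all_algebra all_field.
From mathcomp Require Import zify ring lra.
Import Order.TTheory GRing.Theory Num.Theory.

Set Implicit Arguments.
Unset Strict Implicit.
Unset Printing Implicit Defensive.

(** Lower bound: disjoint cliques with fewer vertices than the star give
    [k^(9/2) n]. If [n >= 8 k^2], a linear space whose blocks (cliques) have [2k]
    points gives [k^2 n^2], because all edges through a common pair lie in a
    single block. If [n < 8 k^2], the clique bound dominates up to a constant.

    Upper bound: for every vertex [v], the vertices of a maximal family of
    disjoint [k]-petal sunflowers in the link of [v] form a set [B v] of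
    size [O(k^(3/2))], and off [B v] the link of every pair [v, u] has a vertex
    cover of size [2k]. Moreover at most [sqrt k] vertices [u] are rich for [v],
    i.e. span with [v] a pair whose link has a matching of size larger than the
    star; the link of a poor pair has a cover of size [O(k^(3/2))]. Every edge is
    then determined by a few free vertices and choices in these sets. *)

(** * Copies of the generalised star *)

Notation St4 s k := (gen_star s [:: k; 1]).

Definition apex s k : vertex (St4 s k) := None.
Definition center s k (i : 'I_s) : vertex (St4 s k) := Some (i, None).
Definition petal1 s k (i : 'I_s) (j : 'I_k) : vertex (St4 s k) :=
  Some (i, Some (j, None)).
Definition petal2 s k (i : 'I_s) (j : 'I_k) : vertex (St4 s k) :=
  Some (i, Some (j, Some ord0)).

(** Unfolds the recursion, so that later arguments see each edge as apex, centre and two petal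
    vertices. *)
Lemma St4_edges s k : edges (St4 s k) =
  [set [set apex s k; center k i; petal1 i j; petal2 i j] | i : 'I_s, j : 'I_k].
Proof.
have im2 (A B : finType) (h : A -> B) (x y : A) (X : {set A}) :
  X = [set x; y] -> [set h z | z in X] = [set h x; h y].
  by move=> ->; rewrite imsetU1 imset_set1.
have im3 (A B : finType) (h : A -> B) (x y z : A) (X : {set A}) :
  X = [set x; y; z] -> [set h t | t in X] = [set h x; h y; h z].
  by move=> ->; rewrite !imsetU !imset_set1.
apply/setP=> e; apply/imsetP/imset2P.
  case=> e1 /imset2P[i e2 _ /imsetP[e3 /imset2P[j e4 _ /imsetP[l _ e4E] e3E] e2E] e1E] eE.
  exists i j => //.
  rewrite {}eE {}e1E {}e2E.
  rewrite e3E e4E (ord1 l) !(imsetU, imset_set1) /apex /center /petal1 /petal2.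
  by rewrite !setUA.
case=> i j _ _ ->.
pose e4 : {set vertex (star_graph 1)} := [set None; Some ord0].
have He4 : e4 \in edges (star_graph 1) by apply/imsetP; exists ord0.
pose e3 : {set vertex (disjoint_copies k (star_graph 1))} := [set (j, x) | x in e4].
have He3 : e3 \in edges (disjoint_copies k (star_graph 1)).
  by apply/imset2P; exists j e4.
pose e2 : {set vertex (gen_star k [:: 1])} := None |: [set Some x | x in e3].
have He2 : e2 \in edges (gen_star k [:: 1]) by apply/imsetP; exists e3.
pose e1 : {set vertex (disjoint_copies s (gen_star k [:: 1]))} := [set (i, x) | x in e2].
have He1 : e1 \in edges (disjoint_copies s (gen_star k [:: 1])).
  by apply/imset2P; exists i e2.
exists e1 => //.
rewrite /e1 /e2 /e3 /e4 !(imsetU, imset_set1) /apex /center /petal1 /petal2.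
by rewrite !setUA.
Qed.

Lemma has_copy_St4P s k (T : finType) (E : {set {set T}}) :
  reflect (exists2 f : vertex (St4 s k) -> T, injective f &
     forall i j, [set f (apex s k); f (center k i); f (petal1 i j); f (petal2 i j)]
       \in E)
    (has_copy (St4 s k) E).
Proof.
apply: (iffP existsP) => [[f /andP[/injectiveP f_inj /forall_inP fE]]|[f f_inj fE]].
  exists f => // i j.
  have := fE [set apex s k; center k i; petal1 i j; petal2 i j].
  rewrite !(imsetU, imset_set1); apply.
  by rewrite St4_edges; apply/imset2P; exists i j.
exists (finfun f); apply/andP; split.
  by apply/injectiveP => x y; rewrite !ffunE; apply: f_inj.
apply/forall_inP=> e; rewrite St4_edges => /imset2P[i j _ _ ->].
by rewrite !(imsetU, imset_set1) !ffunE.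
Qed.

Definition pair_verts (T : eqType) (w : seq (T * T)) : seq T :=
  flatten [seq [:: q.1; q.2] | q <- w].

Definition star_verts (T : eqType) (l : seq (T * seq (T * T))) : seq T :=
  flatten [seq p.1 :: pair_verts p.2 | p <- l].

(** [p] is a sunflower in the link of [v]: centre [p.1], petals [p.2]. Disjointness is left to the
    [uniq] condition of [is_star], which treats all flowers at once; with lists, a star is extended
    by consing a flower. *)
Definition is_flower (T : finType) (E : {set {set T}}) (k : nat) v
    (p : T * seq (T * T)) : bool :=
  (size p.2 == k) && all (fun q => [set v; p.1; q.1; q.2] \in E) p.2.

Definition is_star (T : finType) (E : {set {set T}}) (k : nat) v
    (l : seq (T * seq (T * T))) : bool :=
  uniq (v :: star_verts l) && all (is_flower E k v) l.

Lemma uniq_flatten_nth (T : eqType) (ss : seq (seq T)) i :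
  uniq (flatten ss) -> uniq (nth [::] ss i).
Proof.
elim: ss i => [|s ss IH] [|i] //=; rewrite cat_uniq => /and3P[] //.
by move=> _ _ /IH.
Qed.

Lemma uniq_flatten_eq (T : eqType) (ss : seq (seq T)) i j x :
  uniq (flatten ss) -> i < size ss -> j < size ss ->
  x \in nth [::] ss i -> x \in nth [::] ss j -> i = j.
Proof.
have mem (s : seq T) ss' m : m < size ss' -> x \in nth [::] ss' m -> x \in s ->
   has [in s] (flatten ss') .
  move=> lem xs' xs; apply/hasP; exists x => //.
  by apply/flattenP; exists (nth [::] ss' m) => //; rewrite mem_nth.
elim: ss i j => [|s ss IH] [|i] [|j] //=; rewrite cat_uniq => /and3P[_ dis u].
- by move=> _ lj xs xj; move: dis; rewrite (mem s ss j).
- by move=> li _ xi xs; move: dis; rewrite (mem s ss i).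
- by move=> li lj xi xj; rewrite (IH i j).
Qed.

Lemma pair_verts_nth (T : eqType) (w : seq (T * T)) x0 i : i < size w ->
  [:: (nth x0 w i).1; (nth x0 w i).2] =
    nth [::] [seq [:: q.1; q.2] | q <- w] i.
Proof. by move=> iw; rewrite (nth_map x0). Qed.

(** The Booleans select a coordinate, so this is injectivity of the labelling of petal vertices by
    an index and a side. *)
Lemma uniq_pair_verts (T : eqType) (w : seq (T * T)) x0 i j (a b : bool) :
  uniq (pair_verts w) -> i < size w -> j < size w ->
  (if a then (nth x0 w i).2 else (nth x0 w i).1) =
  (if b then (nth x0 w j).2 else (nth x0 w j).1) -> (i = j) /\ (a = b).
Proof.
move=> u iw jw eqx.
have memq (q : T * T) (c : bool) : (if c then q.2 else q.1) \in [:: q.1; q.2].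
  by case: c; rewrite !inE eqxx ?orbT.
have ij : i = j.
  apply: (@uniq_flatten_eq _ [seq [:: q.1; q.2] | q <- w] _ _
    (if a then (nth x0 w i).2 else (nth x0 w i).1)) => //; rewrite ?size_map //.
    by rewrite -(pair_verts_nth x0).
  by rewrite eqx -(pair_verts_nth x0).
split=> //; move: eqx; rewrite ij.
have := uniq_flatten_nth j u; rewrite -(pair_verts_nth x0) //= inE andbT.
by case: a b => [] [] // + /esym eqx; rewrite ?eqx ?eqxx // -eqx eqxx.
Qed.

Lemma mem_pair_verts (T : eqType) (w : seq (T * T)) x0 i (a : bool) :
  i < size w ->
  (if a then (nth x0 w i).2 else (nth x0 w i).1) \in pair_verts w.
Proof.
move=> iw; apply/flattenP; exists [:: (nth x0 w i).1; (nth x0 w i).2].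
  by apply/mapP; exists (nth x0 w i); rewrite ?mem_nth.
by case: a; rewrite !inE eqxx ?orbT.
Qed.

Lemma star_has_copy (T : finType) (E : {set {set T}}) s k v l :
  is_star E k v l -> size l = s -> has_copy (St4 s k) E.
Proof.
move=> /andP[/= /andP[vl ul] /allP fl] sl.
pose P (i : 'I_s) := nth (v, [::]) l i.
have lt_i (i : 'I_s) : i < size l by rewrite sl.
have Pl i : P i \in l by rewrite mem_nth.
have sP i : size (P i).2 = k by have /andP[/eqP] := fl _ (Pl i).
have lt_j i (j : 'I_k) : j < size (P i).2 by rewrite sP.
have PE i q : q \in (P i).2 -> [set v; (P i).1; q.1; q.2] \in E.
  by have /andP[_ /allP] := fl _ (Pl i); apply.
pose S i := (P i).1 :: pair_verts (P i).2.
have SE i : S i = nth [::] [seq p.1 :: pair_verts p.2 | p <- l] i.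
  by rewrite (nth_map (v, [::])).
have Sl i x : x \in S i -> x \in star_verts l.
  move=> xS; apply/flattenP; exists (S i) => //.
  by apply/mapP; exists (P i).
have uS i : uniq (S i) by rewrite SE; apply: uniq_flatten_nth.
have Sdis i j x : x \in S i -> x \in S j -> i = j.
  rewrite !SE => xi xj; apply/val_inj.
  by apply: uniq_flatten_eq ul _ _ xi xj; rewrite size_map.
pose Q i j := nth (v, v) (P i).2 j.
(* [None] in the innermost option is the first vertex of a petal and [Some ord0] the second, so
   [isSome] selects the side. *)
pose g (r : option ('I_k * option 'I_1)) i : T :=
  if r is Some (j, b) then (if isSome b then (Q i j).2 else (Q i j).1)
  else (P i).1.
pose f (x : option ('I_s * option ('I_k * option 'I_1))) : T :=
  if x is Some (i, r) then g r i else v.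
have gS r i : g r i \in S i.
  case: r => [[j b]|]; rewrite inE ?eqxx //=.
  by apply/orP; right; apply: mem_pair_verts.
have g_inj i : injective (g^~ i).
  have gc (j : 'I_k) (b : option 'I_1) : (if isSome b then (Q i j).2 else (Q i j).1) <> (P i).1.
    have := @mem_pair_verts _ _ (v, v) _ (isSome b) (lt_j i j).
    by move=> + eqc; rewrite eqc; have /andP[/negbTE ->] := uS i.
  move=> [[j b]|] [[j' b']|] //= eqx.
  - have /andP[_ uw] := uS i.
    have [jj bb] := uniq_pair_verts uw (lt_j i j) (lt_j i j') eqx.
    rewrite (val_inj jj); congr (Some (_, _)).
    by case: b b' bb {eqx} => [b|] [b'|] //; rewrite (ord1 b) (ord1 b').
  - by case: (gc _ _ eqx).
  - by case: (gc _ _ (esym eqx)).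
apply/has_copy_St4P; exists f => [x y|i j]; last first.
  by apply: PE; apply: mem_nth.
case: x y => [[i r]|] [[i' r']|] //= eqx.
- have ii : i = i' by apply: Sdis (gS r i) _; rewrite eqx.
  by move: eqx; rewrite -ii => /g_inj ->.
- by move: vl; rewrite -eqx (Sl i).
- by move: vl; rewrite eqx (Sl i').
Qed.

(** * Blockers and rich pairs *)

Lemma uniq_card4 (T : finType) (a b c d : T) :
  #|[set a; b; c; d]| = 4 -> uniq [:: a; b; c; d].
Proof.
move=> card4; apply/card_uniqP; rewrite -[RHS]card4.
by apply: eq_card => x; rewrite !inE !orbA.
Qed.

Lemma uniform_uniq (T : finType) (E : {set {set T}}) (a b c d : T) :
  uniform 4 E -> [set a; b; c; d] \in E -> uniq [:: a; b; c; d].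
Proof. by move=> /forall_inP uE /uE /eqP; apply: uniq_card4. Qed.

Lemma size_pair_verts (T : eqType) (w : seq (T * T)) :
  size (pair_verts w) = 2 * size w.
Proof. by elim: w => //= q w IH; rewrite [size _]/= IH; lia. Qed.

Lemma mem_pair_vertsP (T : eqType) (w : seq (T * T)) x :
  reflect (exists2 q, q \in w & x \in [:: q.1; q.2]) (x \in pair_verts w).
Proof.
apply: (iffP flattenP) => [[_ /mapP[q qw ->] xq]|[q qw xq]]; first by exists q.
by exists [:: q.1; q.2] => //; apply/mapP; exists q.
Qed.

Lemma pair_verts_take (T : eqType) (w : seq (T * T)) k :
  pair_verts (take k w) = take (2 * k) (pair_verts w).
Proof.
elim: w k => [|q w IH] [|k] //.
have -> : 2 * k.+1 = (2 * k).+2 by lia.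
by congr [:: _, _ & _]; apply: IH.
Qed.

Lemma pair_verts_filter (T : eqType) (w : seq (T * T)) p :
  subseq (pair_verts (filter p w)) (pair_verts w).
Proof.
elim: w => //= q w IH; case: (p q) => /=; first by rewrite !eqxx.
exact: subseq_trans (subseq_trans IH (subseq_cons _ _)) (subseq_cons _ _).
Qed.

(** Greedy argument: a matching outside [X] either gains one more pair or its own vertices already
    form a cover. *)
Lemma matching_or_cover (T : finType) (Q : rel T) (X : {set T}) t :
  (exists w, [/\ size w = t, uniq (pair_verts w), all (fun q => Q q.1 q.2) w &
     {in pair_verts w, forall x, x \notin X}]) \/
  (exists2 C : {set T}, #|C| <= 2 * t &
     forall x y, Q x y -> x != y -> x \notin X -> y \notin X ->
       (x \in C) || (y \in C)).
Proof.
elim: t => [|t [[w [sw uw Qw wX]]|[C leC CP]]]; first by left; exists [::].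
  pose D : {set T} := [set x in pair_verts w].
  have leD : #|D| <= 2 * t by rewrite cardsE -sw -size_pair_verts card_size.
  have [/existsP[x /existsP[y]] | noxy] :=
    boolP [exists x, exists y, [&& Q x y, x != y, x \notin X, y \notin X &
      ~~ ((x \in D) || (y \in D))]].
    rewrite !inE => /and5P[Qxy xy xX yX /norP[xw yw]].
    left; exists ((x, y) :: w); split=> //=; first by rewrite sw.
    - by rewrite !inE negb_or xy xw yw.
    - by rewrite Qxy.
    by move=> z; rewrite !inE => /or3P[/eqP->|/eqP->|/wX].
  right; exists D => [|x y Qxy xy xX yX]; first lia.
  apply/negPn/negP=> nD; case/negP: noxy.
  by apply/existsP; exists x; apply/existsP; exists y; rewrite Qxy xy xX yX.
by right; exists C => //; lia.
Qed.

(** [C] is a vertex cover of the graph link of the pair [v], [u] once the vertices of [X] are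
    deleted; [X = set0] gives a cover of the whole link. *)
Definition covers (T : finType) (E : {set {set T}}) v u (X C : {set T}) : Prop :=
  forall x y, [set v; u; x; y] \in E -> x \notin X -> y \notin X ->
    (x \in C) || (y \in C).

Lemma flower_or_cover (T : finType) (E : {set {set T}}) v u (X : {set T}) t :
  uniform 4 E ->
  (exists w, [/\ is_flower E t v (u, w), uniq (pair_verts w) &
     {in pair_verts w, forall x, x \notin X}]) \/
  (exists2 C : {set T}, #|C| <= 2 * t & covers E v u X C).
Proof.
move=> uE.
have [[w [sw uw Ew wX]]|[C leC CP]] :=
    matching_or_cover (fun x y => [set v; u; x; y] \in E) X t.
  by left; exists w; split=> //; rewrite /is_flower /= sw eqxx.
right; exists C => // x y Exy; apply: CP => //.
by have := uniform_uniq uE Exy; rewrite /= !inE => /and4P[].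
Qed.

Lemma flower_notin (T : finType) (E : {set {set T}}) k v u w :
  uniform 4 E -> is_flower E k v (u, w) ->
  v \notin pair_verts w /\ u \notin pair_verts w.
Proof.
move=> uE /andP[_ /allP Ew].
have q_uniq q : q \in w -> (v \notin [:: q.1; q.2]) && (u \notin [:: q.1; q.2]).
  move=> /Ew /(uniform_uniq uE); rewrite /= !inE.
  by case: (v == _); case: (v == _); case: (v == _); case: (u == _); case: (u == _).
by split; apply/negP=> /mem_pair_vertsP[q /q_uniq/andP[/negP hv /negP hu]].
Qed.

Lemma flower_neq (T : finType) (E : {set {set T}}) k v u w :
  uniform 4 E -> 0 < k -> is_flower E k v (u, w) -> v != u.
Proof.
move=> uE k0 /andP[/= /eqP sw /allP Ew]; case: w sw Ew => [|q w] sw Ew.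
  by rewrite -sw in k0.
have /(uniform_uniq uE) := Ew q (mem_head _ _).
by rewrite /= !inE !negb_or => /andP[/andP[]].
Qed.

Lemma size_star_verts (T : finType) (E : {set {set T}}) k v l :
  all (is_flower E k v) l -> size (star_verts l) = size l * (2 * k).+1.
Proof.
elim: l => //= p l IH /andP[/andP[/eqP sp _] /IH].
by rewrite [size _]/= size_cat size_pair_verts sp => ->; lia.
Qed.

Lemma star_apex_notin (T : finType) (E : {set {set T}}) k v l :
  uniform 4 E -> 0 < k -> all (is_flower E k v) l -> v \notin star_verts l.
Proof.
move=> uE k0 /allP fl; apply/negP=> /flattenP[_ /mapP[[u w] /fl fp ->]].
rewrite inE (negbTE (flower_neq uE k0 fp)) /=.
by have [/negbTE ->] := flower_notin uE fp.
Qed.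

(* The blocker consists of the vertices of a maximal family of disjoint
   flowers centred in the link of [v]. *)
Lemma exists_blocker (T : finType) (E : {set {set T}}) s k v :
  uniform 4 E -> 0 < k -> ~~ has_copy (St4 s k) E ->
  exists (B : {set T}) (C : T -> {set T}),
    [/\ v \notin B, #|B| <= s * (2 * k).+1, forall u, #|C u| <= 2 * k &
      forall u, u \notin B -> covers E v u B (C u)].
Proof.
move=> uE k0 nocopy.
have blocked j : (exists2 l, is_star E k v l & size l = j) \/
    exists (B : {set T}) (C : T -> {set T}),
    [/\ v \notin B, #|B| <= j * (2 * k).+1, forall u, #|C u| <= 2 * k &
      forall u, u \notin B -> covers E v u B (C u)].
  elim: j => [|j [[l sl lj]|[B [C [vB leB leC CP]]]]].
  - by left; exists [::].
  - have /andP[/= /andP[vl ul] fl] := sl.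
    pose B : {set T} := [set x in star_verts l].
    have [[u [w [uB fp uw wB]]]|noflower] := EM (exists u w, [/\ u \notin B,
        is_flower E k v (u, w), uniq (pair_verts w) &
        {in pair_verts w, forall x, x \notin B}]).
      left; exists ((u, w) :: l); last by rewrite /= lj.
      have fl' : all (is_flower E k v) ((u, w) :: l) by rewrite /= fp fl.
      rewrite /is_star fl' andbT cons_uniq (star_apex_notin uE k0 fl') /=.
      have [_ uNw] := flower_notin uE fp.
      rewrite mem_cat negb_or uNw /= cat_uniq uw ul andbT /=.
      move: uB; rewrite inE => ->; apply/hasPn=> x xl.
      by apply/negP=> /wB; rewrite inE xl.
    right; have cov u : exists C : {set T}, #|C| <= 2 * k /\
        (u \notin B -> covers E v u B C).
      have [[w [fp uw wB]]|[C leC CP]] := flower_or_cover v u B k uE.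
        (* A flower centred at [u] avoids [B], so by maximality [u] lies in [B] and the cover
           condition is vacuous. *)
        exists set0; split=> [|uB]; first by rewrite cards0.
        by case: noflower; exists u, w.
      by exists C.
    have [C CP] := fin_all_exists cov.
    exists B, C; split=> [||u|u]; try by case: (CP u).
    + by rewrite inE.
    + rewrite cardsE; apply: leq_trans (card_size _) _.
      by rewrite (size_star_verts fl) lj leq_mul2r leqnSn orbT.
  - by right; exists B, C; split=> //; lia.
have [[l sl ls]|//] := blocked s.
by rewrite (star_has_copy sl ls) in nocopy.
Qed.

(** The pairs are disjoint, so each element of [F] spoils at most one of them. *)
Lemma avoiding_pairs (T : finType) (w : seq (T * T)) (F : {set T}) :
  uniq (pair_verts w) ->
  size w <= size [seq q <- w | (q.1 \notin F) && (q.2 \notin F)] + #|F|.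
Proof.
move=> uw; have leF : size [seq x <- pair_verts w | x \in F] <= #|F|.
  rewrite cardE; apply: uniq_leq_size; first exact: filter_uniq.
  by move=> x; rewrite mem_filter mem_enum => /andP[].
apply: leq_trans (leq_add (leqnn _) leF).
rewrite /pair_verts; elim: w {uw leF} => //= q w.
by case: (q.1 \in F); case: (q.2 \in F) => /=; lia.
Qed.

(** Greedy choice of flowers. Of the [s + s * (2 * k).+1 + k] available petals, at most [s] meet [U]
    and at most [s * (2 * k).+1] meet the star built so far, so [k] remain. Avoiding [U] keeps later
    centres free; the last conclusion carries this through the induction. *)
Lemma rich_star (T : finType) (E : {set {set T}}) (U : {set T}) s k v us :
  uniform 4 E -> 0 < k -> #|U| <= s -> size us <= s ->
  uniq us -> {subset us <= U} ->
  (forall u, u \in us -> exists2 w, is_flower E (s + s * (2 * k).+1 + k) v (u, w) &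
     uniq (pair_verts w)) ->
  exists l, [/\ map fst l = us, is_star E k v l &
    forall x, x \in star_verts l -> x \in U -> x \in us].
Proof.
move=> uE k0 leU; elim: us => [|u us IH] /= les; first by exists [::].
move=> /andP[uus uqus] subU rich.
have [x xus|x xus|l [lus sl lU]] := IH (ltnW les) uqus.
- by apply: subU; rewrite inE xus orbT.
- by apply: rich; rewrite inE xus orbT.
have /andP[/= /andP[vl ul] fl] := sl.
have uU : u \in U by apply: subU; rewrite mem_head.
have [w /andP[/= /eqP sw /allP Ew] uw] := rich _ (mem_head _ _).
pose F := U :|: [set x in star_verts l].
have leF : #|F| <= s + s * (2 * k).+1.
  apply: leq_trans (leq_card_setU _ _) _; apply: leq_add => //.
  rewrite cardsE; apply: leq_trans (card_size _) _.
  by rewrite (size_star_verts fl) leq_mul2r -(size_map fst) lus ltnW ?orbT.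
set fw := [seq q <- w | (q.1 \notin F) && (q.2 \notin F)].
have le_fw : k <= size fw.
  by have := avoiding_pairs F uw; rewrite -/fw sw; lia.
pose w' := take k fw.
have w'w q : q \in w' -> [&& q \in w, q.1 \notin F & q.2 \notin F].
  by move=> /mem_take; rewrite mem_filter andbC => /andP[-> ->].
have w'F x : x \in pair_verts w' -> x \notin F.
  move=> /mem_pair_vertsP[q /w'w /and3P[_ q1 q2]].
  by rewrite in_cons mem_seq1 => /orP[]/eqP->.
have fp : is_flower E k v (u, w').
  rewrite /is_flower /= size_takel // eqxx; apply/allP=> q /w'w /and3P[qw _ _].
  exact: Ew.
have uw' : uniq (pair_verts w').
  by rewrite pair_verts_take take_uniq // (subseq_uniq _ uw) // pair_verts_filter.
have fl' : all (is_flower E k v) ((u, w') :: l) by rewrite /= fp fl.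
exists ((u, w') :: l); split; first by rewrite /= lus.
  rewrite /is_star fl' andbT cons_uniq (star_apex_notin uE k0 fl') /=.
  have [_ uNw] := flower_notin uE fp.
  rewrite mem_cat negb_or uNw /= cat_uniq uw' ul andbT /=.
  apply/andP; split; first by apply/negP=> /lU /(_ uU); apply/negP.
  apply/hasPn=> x xl; apply/negP=> /w'F.
  by rewrite !inE xl orbT.
move=> x; rewrite /= inE mem_cat => /or3P[/eqP-> _|/w'F|/lU h /h xus].
- exact: mem_head.
- by rewrite !inE => /norP[/negbTE->].
by rewrite inE xus orbT.
Qed.

(** More than [s] rich vertices would supply the centres of a star by [rich_star]; a vertex that is
    not rich gets a cover from [flower_or_cover]. *)
Lemma few_rich (T : finType) (E : {set {set T}}) s k v :
  uniform 4 E -> 0 < k -> ~~ has_copy (St4 s k) E ->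
  exists (R : {set T}) (K : T -> {set T}),
    [/\ #|R| <= s, forall u, #|K u| <= 2 * (s + s * (2 * k).+1 + k) &
      forall u, u \notin R -> covers E v u set0 (K u)].
Proof.
move=> uE k0 nocopy; set N := _ + k.
pose R := [set u | `[< exists2 w, is_flower E N v (u, w) & uniq (pair_verts w) >]].
have cov u : exists C : {set T}, #|C| <= 2 * N /\
    (u \notin R -> covers E v u set0 C).
  have [[w [fp uw _]]|[C leC CP]] := flower_or_cover v u set0 N uE.
    exists set0; split=> [|]; first by rewrite cards0.
    by rewrite inE => /asboolPn[]; exists w.
  by exists C.
have [K KP] := fin_all_exists cov.
exists R, K; split=> [|u|u]; try by case: (KP u).
rewrite leqNgt; apply/negP=> ltR; case/negP: nocopy.
pose us := take s (enum R).
have sus : size us = s by rewrite size_takel // -cardE ltnW.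
have uus : uniq us by rewrite take_uniq ?enum_uniq.
have leU : #|[set u in us]| <= s by rewrite cardsE -sus card_size.
have [u|u uus'|l [lus sl _]] := rich_star uE k0 leU (eq_leq sus) uus (v := v).
- by rewrite inE.
- by have /mem_take := uus'; rewrite mem_enum inE => /asboolP.
by apply: star_has_copy sl _; rewrite -(size_map fst) lus.
Qed.

(** * Counting the edges of a star-free 4-graph *)

Ltac set_perm := by apply/setP => ?; rewrite !inE; do ![case: (_ == _)].

Lemma card_bigcup_leq (I T : finType) (A : {set I}) (F : I -> {set T}) x y :
  #|A| <= x -> (forall i, #|F i| <= y) -> #|\bigcup_(i in A) F i| <= x * y.
Proof.
move=> leA leF; apply: (@leq_trans (\sum_(i in A) y)); last first.
  by rewrite sum_nat_const leq_mul2r leA orbT.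
apply: (big_ind2 (fun (X : {set T}) m => #|X| <= m)) => //; first by rewrite cards0.
move=> X m Y m' leX leY.
exact: leq_trans (leq_card_setU _ _) (leq_add leX leY).
Qed.

(** Counts edges by successive choices: a free root, then each vertex in a set of bounded size that
    depends on the earlier ones. *)
Lemma card_chain (T : finType) (F : {set {set T}}) (X : T -> {set T})
    (Y : T -> T -> {set T}) (Z : T -> T -> T -> {set T}) x y z :
  (forall a, #|X a| <= x) -> (forall a b, #|Y a b| <= y) ->
  (forall a b c, #|Z a b c| <= z) ->
  (forall e, e \in F -> exists a b c d,
     [/\ b \in X a, c \in Y a b, d \in Z a b c & e = [set a; b; c; d]]) ->
  #|F| <= #|T| * (x * (y * z)).
Proof.
move=> leX leY leZ FP.
pose G := \bigcup_(a in [set: T]) \bigcup_(b in X a) \bigcup_(c in Y a b)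
  [set [set a; b; c; d] | d in Z a b c].
have /subset_leq_card leFG : F \subset G.
  apply/subsetP=> e /FP[a [b [c [d [bX cY dZ ->]]]]].
  apply/bigcupP; exists a => //; apply/bigcupP; exists b => //.
  by apply/bigcupP; exists c => //; apply: imset_f.
apply: leq_trans leFG _; apply: card_bigcup_leq => [|a]; first by rewrite cardsT.
apply: card_bigcup_leq => // b; apply: card_bigcup_leq => // c.
exact: leq_trans (leq_imset_card _ _) _.
Qed.

(** Orders the triple so that arcs reach it from the root [x]. An arc [p -> q] either continues to
    [r], or is part of a two-cycle which the arc leaving [r] enters. *)
Lemma three_root (T : finType) (D : rel T) (e : {set T}) a b c :
  irreflexive D -> e = [set a; b; c] ->
  {in e, forall v, exists2 w, w \in e & D v w} ->
  exists x y z, [/\ e = [set x; y; z], D x y & D x z || D y z].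
Proof.
move=> irr eE out.
have path p q r : e = [set p; q; r] -> D p q ->
    exists x y z, [/\ e = [set x; y; z], D x y & D x z || D y z].
  move=> {}eE pq.
  have [|w] := out q; rewrite eE !inE ?eqxx ?orbT //.
  rewrite -orbA => /or3P[]/eqP-> {w}; rewrite ?irr // => qw; last first.
    by exists p, q, r; rewrite qw orbT.
  have [|w] := out r; rewrite eE !inE ?eqxx ?orbT //.
  rewrite -orbA => /or3P[]/eqP-> {w}; rewrite ?irr // => rw.
  - by exists r, p, q; rewrite rw pq orbT; split=> //; set_perm.
  - by exists r, q, p; rewrite rw qw orbT; split=> //; set_perm.
have [|w] := out a; rewrite eE !inE ?eqxx ?orbT //.
rewrite -orbA => /or3P[]/eqP-> {w}; rewrite ?irr // -eE => aw.
  exact: path eE aw.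
by apply: (path a c b) aw; rewrite eE; set_perm.
Qed.

(** A spanning out-tree rooted at [x]: each later vertex receives an arc from an earlier one. *)
Definition chain4 (T : finType) (D : rel T) (x y z t : T) : bool :=
  [&& D x y, D x z || D y z & [|| D x t, D y t | D z t]].

Definition two_cycle4 (T : finType) (D : rel T) (x y z t : T) : bool :=
  [&& D z t, D t z &
    D x y && D y x || (D x z || D x t) && (D y z || D y t)].

(** Suppose there is a path [p -> q -> r]. If it does not reach [t], then [t] points into it. If
    moreover [r -> p], the three-cycle is reached from [t]. Otherwise [r -> q], and either [t -> p]
    starts a chain or both [p] and [t] point into the two-cycle on [q], [r]. With no such path, the
    arcs form two disjoint two-cycles. *)
Lemma chain_or_two_cycle (T : finType) (D : rel T) (e : {set T}) a b c d :
  irreflexive D -> e = [set a; b; c; d] ->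
  {in e, forall v, exists2 w, w \in e & D v w} ->
  exists x y z t, e = [set x; y; z; t] /\ (chain4 D x y z t || two_cycle4 D x y z t).
Proof.
move=> irr eE out; pose good := exists x y z t,
  e = [set x; y; z; t] /\ (chain4 D x y z t || two_cycle4 D x y z t).
have outs p q r t : e = [set p; q; r; t] -> [|| D p q, D p r | D p t].
  move=> {}eE; have [|w] := out p; rewrite eE !inE ?eqxx ?orbT //.
  by rewrite -!orbA => /or4P[]/eqP-> pw; [rewrite irr in pw | rewrite pw ?orbT ..].
have path p q r t : e = [set p; q; r; t] -> D p q -> D q r -> good.
  move=> {}eE pq qr.
  have [] := boolP [|| D p t, D q t | D r t] => [pqrt|].
    by exists p, q, r, t; rewrite /chain4 pq qr pqrt orbT.
  rewrite !negb_or => /and3P[/negbTE pt /negbTE qt /negbTE rt].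
  have : [|| D t p, D t q | D t r] by apply: outs; rewrite eE; set_perm.
  have : [|| D r p, D r q | D r t] by apply: outs; rewrite eE; set_perm.
  rewrite rt orbF; case: (boolP (D r p)) => [rp _|rNp /= rq].
    case/or3P=> tw.
    - exists t, p, q, r; rewrite /chain4 tw pq qr !orbT; split=> //.
      by rewrite eE; set_perm.
    - exists t, q, r, p; rewrite /chain4 tw qr rp !orbT; split=> //.
      by rewrite eE; set_perm.
    - exists t, r, p, q; rewrite /chain4 tw rp pq !orbT; split=> //.
      by rewrite eE; set_perm.
  case/or3P=> tw.
  - exists t, p, q, r; rewrite /chain4 tw pq qr !orbT; split=> //.
    by rewrite eE; set_perm.
  - exists p, t, q, r; rewrite /two_cycle4 qr rq pq tw !orbT; split=> //.
    by rewrite eE; set_perm.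
  - exists p, t, q, r; rewrite /two_cycle4 qr rq pq tw !orbT; split=> //.
    by rewrite eE; set_perm.
have arc p q r t : e = [set p; q; r; t] -> D p q -> good.
  move=> {}eE pq.
  have eE1 : e = [set q; p; r; t] by rewrite eE; set_perm.
  case/or3P: (outs _ _ _ _ eE1) => qw; last 2 first.
  - exact: path eE pq qw.
  - by apply: (path p q t r) => //; rewrite eE; set_perm.
  have eE2 : e = [set r; p; q; t] by rewrite eE; set_perm.
  case/or3P: (outs _ _ _ _ eE2) => rw.
  - by apply: (path r p q t) => //; rewrite eE; set_perm.
  - by apply: (path r q p t) => //; rewrite eE; set_perm.
  have eE3 : e = [set t; p; q; r] by rewrite eE; set_perm.
  case/or3P: (outs _ _ _ _ eE3) => tw.
  - by apply: (path r t p q) => //; rewrite eE; set_perm.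
  - by apply: (path r t q p) => //; rewrite eE; set_perm.
  by exists p, q, r, t; rewrite /two_cycle4 rw tw pq qw !orbT.
case/or3P: (outs _ _ _ _ eE) => aw; first exact: arc eE aw.
- by apply: (arc a c b d) => //; rewrite eE; set_perm.
- by apply: (arc a d b c) => //; rewrite eE; set_perm.
Qed.

Lemma card_setU_leq (T : finType) (A B : {set T}) x y :
  #|A| <= x -> #|B| <= y -> #|A :|: B| <= x + y.
Proof. by move=> lA lB; apply: leq_trans (leq_card_setU _ _) (leq_add lA lB). Qed.

(* If some [v \in e] has no blocking vertex in [e], the 2k-covers reach [e :\ v]
   from a root, so [e] costs [n] for [v], [n] for the root and [O(k)] for each of
   the other two vertices. Otherwise the blocking relation has out-degree at least
   1 inside [e]: either it reaches [e] from a root, or it contains a two-cycle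
   [z <-> t]. A rich two-cycle has only [s] choices of [t] given [z]; a poor one
   has a cover of the link of [z, t], which supplies the missing arc of a chain. *)
Lemma St4_free_card (T : finType) (E : {set {set T}}) s k
    (m := s * (2 * k).+1) (N := s + m + k) :
  uniform 4 E -> 0 < k -> ~~ has_copy (St4 s k) E ->
  #|E| <= #|T| * (#|T| * (2 * k * (4 * k)))
        + #|T| * (m * ((2 * m + 2 * N) * (3 * m + 4 * N)))
        + #|T| * (m * (#|T| * (2 * s))).
Proof.
move=> uE k0 nocopy.
have [B Bex] := fin_all_exists (fun v => exists_blocker v uE k0 nocopy).
have [C CP] := fin_all_exists Bex.
have [R Rex] := fin_all_exists (fun v => few_rich v uE k0 nocopy).
have [K KP] := fin_all_exists Rex.
have N0 x : x \notin (set0 : {set T}) by rewrite inE.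
have vB v : v \notin B v by case: (CP v).
have leB v : #|B v| <= m by case: (CP v).
have leC v u : #|C v u| <= 2 * k by case: (CP v).
have covC v u : u \notin B v -> covers E v u (B v) (C v u).
  by case: (CP v) => _ _ _; apply.
have leR v : #|R v| <= s by case: (KP v).
have leK v u : #|K v u| <= 2 * N by case: (KP v).
have covK v u : u \notin R v -> covers E v u set0 (K v u).
  by case: (KP v) => _ _; apply.
(* [E1], [E3] and [E2] account for the three terms of the bound, in this order. [E2] collects the
   edges in which a blocking arc [x -> y] comes with a fourth vertex rich for [y] or for [z]. *)
pose E1 := [set e in E | [exists v in e, [disjoint e & B v]]].
pose E2 := [set e in E | [exists x, exists y, exists z, exists t,
  [&& e == [set x; y; z; t], y \in B x & (t \in R y) || (t \in R z)]]].
pose E3 := E :\: (E1 :|: E2).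
have leE1 : #|E1| <= #|T| * (#|T| * (2 * k * (4 * k))).
  apply: (card_chain (X := fun=> setT) (Y := C) (Z := fun a b c => C a b :|: C a c)).
  - by move=> a; rewrite cardsT.
  - exact: leC.
  - by move=> a b c; apply: leq_trans (card_setU_leq (leC _ _) (leC _ _)) _; lia.
  move=> e; rewrite inE => /andP[eE /existsP[v /andP[ve /pred0P dis]]].
  have e4 : #|e| = 4 by apply/eqP; move/forall_inP: uE => /(_ _ eE).
  have [a [b [c e'E]]] : exists a b c, e :\ v = [set a; b; c].
    have : size (enum (e :\ v)) = 3 by rewrite -cardE; have := cardsD1 v e; rewrite ve; lia.
    case eq_s: (enum (e :\ v)) => [|a [|b [|c [|? ?]]]] // _.
    by exists a, b, c; apply/setP=> x; rewrite -mem_enum eq_s !inE orbA.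
  have eDv p q r : e :\ v = [set p; q; r] -> e = [set v; p; q; r].
    by move=> eq; rewrite -(setD1K ve) eq !setUA.
  have NB x : x \in e -> x \notin B v by move=> xe; have := dis x; rewrite /= xe => /= ->.
  (* The edge misses [B v], so [C v p] meets the other two vertices of [e :\ v]. As [p] itself may
     lie in [C v p], irreflexivity is imposed. *)
  pose D : rel T := fun p q => (q \in C v p) && (q != p).
  have [||x [y [z [xyz Dxy Dz]]]] := @three_root T D (e :\ v) a b c _ e'E.
  - by move=> p; rewrite /D eqxx andbF.
  - have cov p q r : e :\ v = [set p; q; r] ->
        exists2 w, w \in e :\ v & D p w.
      move=> pqr; have eE' := eDv _ _ _ pqr.
      have [pe qe re] : [/\ p \in e, q \in e & r \in e].
        by rewrite eE' !inE !eqxx !orbT.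
      have pqrE : [set v; p; q; r] \in E by rewrite -eE'.
      have /= := uniform_uniq uE pqrE; rewrite !inE !negb_or.
      move=> /and4P[_ /andP[pq pr] _ _].
      case/orP: (covC v p (NB _ pe) q r pqrE (NB _ qe) (NB _ re)) => h.
        by exists q; rewrite /D; [rewrite pqr !inE eqxx orbT | rewrite h eq_sym].
      by exists r; rewrite /D; [rewrite pqr !inE eqxx orbT | rewrite h eq_sym].
    move=> p; rewrite e'E !inE -orbA => /or3P[]/eqP->; rewrite -e'E.
    + exact: cov e'E.
    + by apply: (cov b a c); rewrite e'E; set_perm.
    + by apply: (cov c a b); rewrite e'E; set_perm.
  exists v, x, y, z; split; rewrite ?inE //; first by case/andP: Dxy.
    by case/orP: Dz => /andP[->]; rewrite ?orbT.
  exact: eDv.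
have leE2 : #|E2| <= #|T| * (m * (#|T| * (2 * s))).
  apply: (card_chain (X := B) (Y := fun _ _ => setT) (Z := fun a b c => R b :|: R c)).
  - exact: leB.
  - by move=> a b; rewrite cardsT.
  - by move=> a b c; apply: leq_trans (card_setU_leq (leR _) (leR _)) _; lia.
  move=> e; rewrite inE => /andP[eE].
  case/existsP=> x /existsP[y /existsP[z /existsP[t /and3P[/eqP exyz yx tR]]]].
  by exists x, y, z, t; rewrite !inE.
have leE3 : #|E3| <= #|T| * (m * ((2 * m + 2 * N) * (3 * m + 4 * N))).
  (* Besides blocking arcs, the last two choices may use the cover of a poor pair; both orders of
     [b], [c] are allowed because [K] depends on the order. *)
  apply: (card_chain (X := B) (Y := fun a b => B a :|: B b :|: K a b)
    (Z := fun a b c => B a :|: B b :|: B c :|: (K b c :|: K c b))).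
  - exact: leB.
  - move=> a b; have := card_setU_leq (card_setU_leq (leB a) (leB b)) (leK a b).
    by move/leq_trans; apply; lia.
  - move=> a b c; have := card_setU_leq (card_setU_leq (card_setU_leq (leB a)
      (leB b)) (leB c)) (card_setU_leq (leK b c) (leK c b)).
    by move/leq_trans; apply; lia.
  move=> e; rewrite inE in_setU negb_or => /andP[/andP[eNE1 eNE2] eE].
  have e4 : #|e| = 4 by apply/eqP; move/forall_inP: uE => /(_ _ eE).
  have [a [b [c [d abcd]]]] : exists a b c d, e = [set a; b; c; d].
    have : size (enum e) = 4 by rewrite -cardE.
    case eq_s: (enum e) => [|a [|b [|c [|d [|? ?]]]]] // _.
    by exists a, b, c, d; apply/setP=> x; rewrite -mem_enum eq_s !inE !orbA.
  pose D : rel T := fun p q => q \in B p.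
  have [||x [y [z [t [xyzt cases]]]]] := @chain_or_two_cycle T D e a b c d _ abcd.
  - by move=> p; apply/negbTE; apply: vB.
  - move=> v ve; move: eNE1; rewrite inE eE /= => /existsPn/(_ v).
    by rewrite ve /= -setI_eq0 => /set0Pn[w]; rewrite inE => /andP[we wB]; exists w.
  (* Outside [E2], an arc [p -> q] forces the remaining vertex [u] to be poor for both [q] and
     [r]. *)
  have poor p q r u : e = [set p; q; r; u] -> q \in B p ->
      (u \notin R q) && (u \notin R r).
    move=> pqru qB; rewrite -negb_or; apply: contra eNE2 => uR.
    rewrite inE eE /=; apply/existsP; exists p; apply/existsP; exists q.
    by apply/existsP; exists r; apply/existsP; exists u; rewrite pqru eqxx qB.
  case/orP: cases => [/and3P[xy Dz Dt]|/and3P[zt tz]].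
    exists x, y, z, t; split=> //; rewrite !inE.
      by rewrite (Dz : (z \in B x) || (z \in B y)).
    rewrite -(orbA (t \in B x)).
    by rewrite (Dt : [|| t \in B x, t \in B y | t \in B z]).
  case/orP=> [/andP[xy yx]|/andP[Dx Dy]].
    (* Two disjoint two-cycles: the cover of the poor pair [z], [t] contains [x] or [y], and the
       other one follows by an arc. *)
    have /andP[_ tR] := poor _ _ _ _ xyzt xy.
    have ztxy : e = [set z; t; x; y] by rewrite xyzt; set_perm.
    have Ezt : [set z; t; x; y] \in E by rewrite -ztxy.
    have /orP[xK|yK] := covK z t tR x y Ezt (N0 _) (N0 _).
    + by exists z, t, x, y; rewrite !inE xK (xy : y \in B x) !orbT; split.
    + exists z, t, y, x; rewrite !inE yK (yx : x \in B y) !orbT; split=> //.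
      by rewrite ztxy; set_perm.
  have last_in_cover p q r u : e = [set p; q; r; u] -> D q r -> D r q ->
      D p q || D p r -> (u \in K q r) || (u \in K r q) ->
      exists a b c d, [/\ b \in B a, c \in B a :|: B b :|: K a b,
        d \in B a :|: B b :|: B c :|: (K b c :|: K c b) & e = [set a; b; c; d]].
    move=> pqru qr rq /orP[] pw uK.
      exists p, q, r, u; rewrite !inE uK (qr : r \in B q) !orbT.
      by split.
    exists p, r, q, u; rewrite !inE [(_ \in K r q) || _]orbC uK.
    rewrite (rq : q \in B r) !orbT; split=> //.
    by rewrite pqru; set_perm.
  (* The arc [x -> q] makes the pair [q], [r] poor. Its cover contains [x] or [y]; the other of
     these two serves as root, since it points into the two-cycle. *)
  have poor_end q r : e = [set x; y; q; r] -> D q r -> D r q ->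
      D x q || D x r -> D y q || D y r -> D x q ->
      exists a b c d, [/\ b \in B a, c \in B a :|: B b :|: K a b,
        d \in B a :|: B b :|: B c :|: (K b c :|: K c b) & e = [set a; b; c; d]].
    move=> xyqr qr rq xw yw xq.
    have xqyr : e = [set x; q; y; r] by rewrite xyqr; set_perm.
    have /andP[rR _] := poor _ _ _ _ xqyr xq.
    have qrxy : e = [set q; r; x; y] by rewrite xyqr; set_perm.
    have Eqr : [set q; r; x; y] \in E by rewrite -qrxy.
    have /orP[xK|yK] := covK q r rR x y Eqr (N0 _) (N0 _).
    + by apply: (last_in_cover y q r x); rewrite ?xK // qrxy; set_perm.
    + by apply: (last_in_cover x q r y); rewrite ?yK // qrxy; set_perm.
  case/orP: (Dx) => xw; first exact: (poor_end z t).
  by apply: (poor_end t z); rewrite // 1?orbC // xyzt; set_perm.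
have /subset_leq_card leE : E \subset E1 :|: E3 :|: E2.
  by apply/subsetP=> e eE; rewrite !(inE, in_setD) eE; case: existsP; case: existsP.
apply: leq_trans leE _; exact: card_setU_leq (card_setU_leq leE1 leE3) leE2.
Qed.

(** * Constructions *)

Lemma extremal_ge r n F (E : {set {set 'I_n}}) :
  uniform r E -> ~~ has_copy F E -> #|E| <= extremal r n F.
Proof.
move=> uE nocopy.
rewrite /extremal (@leq_bigmax_cond _ _ (fun E : {set {set 'I_n}} => #|E|)) //.
by rewrite uE.
Qed.

Definition block_edges (I T : finType) (b : I -> {set T}) : {set {set T}} :=
  \bigcup_i [set e : {set T} | (e \subset b i) && (#|e| == 4)].

Lemma block_edgesP (I T : finType) (b : I -> {set T}) (e : {set T}) :
  reflect (exists2 i, e \subset b i & #|e| = 4) (e \in block_edges b).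
Proof.
apply: (iffP bigcupP) => [[i _]|[i eb e4]].
  by rewrite inE => /andP[eb /eqP e4]; exists i.
by exists i; rewrite // inE eb e4.
Qed.

Lemma uniform_block_edges (I T : finType) (b : I -> {set T}) :
  uniform 4 (block_edges b).
Proof. by apply/forall_inP=> e /block_edgesP[i _ ->]. Qed.

Lemma card_block_edges (I T : finType) (b : I -> {set T}) t :
  (forall i, #|b i| = t) -> (forall i j, i != j -> #|b i :&: b j| < 4) ->
  #|block_edges b| = #|I| * 'C(t, 4).
Proof.
move=> card_b lt4; rewrite -sum1_card partition_disjoint_bigcup /=.
  under eq_bigr do rewrite sum1_card cards_draws card_b.
  by rewrite sum_nat_const.
move=> i j ij; rewrite -setI_eq0; apply/set0Pn=> [[e]].
rewrite !inE => /andP[/andP[ei /eqP e4] /andP[ej _]].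
have := lt4 _ _ ij; rewrite ltnNge -e4 subset_leq_card //.
by rewrite subsetI ei ej.
Qed.

(** For [t >= 4] each of [t - 1], [t - 2], [t - 3] is at least [t / 4], whence [64 = 4 ^ 3]. *)
Lemma expn4_le_bin t : 4 <= t -> t ^ 4 <= 64 * (4`! * 'C(t, 4)).
Proof.
move=> t4; rewrite (mulnC _ 'C(t, 4)) bin_ffact !ffactnS ffactn0 muln1.
have -> : 64 * (t * (t.-1 * (t.-2 * t.-2.-1))) =
    t * ((4 * t.-1) * ((4 * t.-2) * (4 * t.-2.-1))).
  by move: t.-1 t.-2 t.-2.-1 => x y z; lia.
by rewrite !expnS muln1 !leq_mul //; lia.
Qed.

Lemma card_St4 s k : #|{: vertex (St4 s k)}| = (s * (2 * k).+1).+1.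
Proof.
rewrite card_option card_prod card_option card_prod card_option !card_ord.
by lia.
Qed.

(** All edges of the star contain the apex, so a copy lies in one of the disjoint blocks; it has one
    vertex more than a block may have. *)
Lemma cliques_St4_free (I T : finType) (b : I -> {set T}) s k :
  0 < s -> 0 < k -> (forall i, #|b i| <= s * (2 * k).+1) ->
  (forall i j x, x \in b i -> x \in b j -> i = j) ->
  ~~ has_copy (St4 s k) (block_edges b).
Proof.
move=> s0 k0 le_b dis; apply/negP=> /has_copy_St4P[f f_inj fE].
have block i j : exists2 c, f (apex s k) \in b c &
    [/\ f (center k i) \in b c, f (petal1 i j) \in b c & f (petal2 i j) \in b c].
  have /block_edgesP[c /subsetP sub _] := fE i j; exists c; last split;
    by apply: sub; rewrite !inE eqxx ?orbT.
have [c vc _] := block (Ordinal s0) (Ordinal k0).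
have all_c x : f x \in b c.
  case: x => [[i [[j [l|]]|]]|] //.
  - have [c' vc' [_ _]] := block i j; rewrite (dis _ _ _ vc vc').
    by rewrite /petal2 (ord1 l).
  - by have [c' vc' []] := block i j; rewrite (dis _ _ _ vc vc').
  - by have [c' vc' []] := block i (Ordinal k0); rewrite (dis _ _ _ vc vc').
have : #|[set f x | x in vertex (St4 s k)]| <= #|b c|.
  by apply/subset_leq_card/subsetP=> _ /imsetP[x _ ->].
by rewrite card_imset // card_St4 => /leq_trans/(_ (le_b c)); rewrite ltnn.
Qed.

(** The edges of one flower share apex and centre, and two points determine the block. Hence the
    [2 k + 2] vertices of apex and flower would lie in a block with at most [2 k + 1] points. *)
Lemma linear_space_St4_free (I T : finType) (b : I -> {set T}) s k :
  0 < s -> 0 < k -> (forall i, #|b i| <= (2 * k).+1) ->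
  (forall i j x y, x != y -> x \in b i -> y \in b i -> x \in b j -> y \in b j ->
     i = j) ->
  ~~ has_copy (St4 s k) (block_edges b).
Proof.
move=> s0 k0 le_b lin; apply/negP=> /has_copy_St4P[f f_inj fE].
pose i0 := Ordinal s0.
have block j : exists2 c, f (apex s k) \in b c &
    [/\ f (center k i0) \in b c, f (petal1 i0 j) \in b c & f (petal2 i0 j) \in b c].
  have /block_edgesP[c /subsetP sub _] := fE i0 j; exists c; last split;
    by apply: sub; rewrite !inE eqxx ?orbT.
have [c vc [uc _ _]] := block (Ordinal k0).
have vu : f (apex s k) != f (center k i0) by apply/eqP=> /f_inj.
pose g (z : option (option ('I_k * bool))) : vertex (St4 s k) :=
  if z is Some r then
    if r is Some (j, a) then (if a then petal1 i0 j else petal2 i0 j)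
    else center k i0
  else apex s k.
have g_inj : injective g.
  by move=> [[[j []]|]|] [[[j' []]|]|] //= -[->].
have all_c z : f (g z) \in b c.
  case: z => [[[j a]|]|] //=.
  have [c' vc' [uc' xc' yc']] := block j.
  by rewrite (lin _ _ _ _ vu vc uc vc' uc'); case: a.
have : #|[set f (g x) | x in {: option (option ('I_k * bool))}]| <= #|b c|.
  by apply/subset_leq_card/subsetP=> _ /imsetP[x _ ->].
rewrite card_imset; last by move=> x y /f_inj /g_inj.
rewrite card_option card_option card_prod card_ord card_bool.
by have := le_b c; lia.
Qed.

Lemma injection_ord (A : finType) n : #|A| <= n -> exists h : A -> 'I_n, injective h.
Proof.
move=> leA; exists (fun x => widen_ord leA (enum_rank x)) => x y /(congr1 val) /= eqr.
by apply: enum_rank_inj; apply: val_inj.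
Qed.

Lemma extremal_ge_cliques n s k t :
  0 < s -> 0 < k -> 4 <= t -> t <= s * (2 * k).+1 ->
  (n %/ t) * t ^ 4 <= 64 * (4`! * extremal 4 n (St4 s k)).
Proof.
move=> s0 k0 t4 tsk.
have [|h h_inj] := @injection_ord ('I_(n %/ t) * 'I_t)%type n.
  by rewrite card_prod !card_ord leq_divM.
pose b i := [set h (i, j) | j : 'I_t].
have card_b i : #|b i| = t by rewrite card_imset ?card_ord // => x y /h_inj[].
have dis i j x : x \in b i -> x \in b j -> i = j.
  by move=> /imsetP[y _ ->] /imsetP[z _ /h_inj[]].
have := @extremal_ge 4 n (St4 s k) _ (uniform_block_edges b).
have le_b i : #|b i| <= s * (2 * k).+1 by rewrite card_b.
move=> /(_ (cliques_St4_free s0 k0 le_b dis)).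
rewrite (card_block_edges card_b) => [|i j ij]; last first.
  rewrite (_ : _ :&: _ = set0) ?cards0 //; apply/setP=> x; rewrite !inE.
  by apply/negP=> /andP[xi xj]; rewrite (dis _ _ _ xi xj) eqxx in ij.
rewrite card_ord => leE.
apply: leq_trans (leq_mul (leqnn 64) (leq_mul (leqnn 4`!) leE)).
by rewrite (mulnCA 4`!) mulnCA leq_mul2l expn4_le_bin // orbT.
Qed.

(* The blocks are the graphs of the affine functions [y = a x + c] over a field
   with [2 ^ j] elements, restricted to [2 k] values of [x]. *)
Lemma extremal_ge_lines n s k j :
  0 < s -> 1 < k -> 0 < j -> 2 * k <= 2 ^ j -> 2 * k * 2 ^ j <= n ->
  (2 ^ j) ^ 2 * (2 * k) ^ 4 <= 64 * (4`! * extremal 4 n (St4 s k)).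
Proof.
move=> s0 k1 j0 kq qn; have [F _ cardF] := pPrimePowerField (isT : prime 2) j0.
set t := 2 * k in kq qn *.
have [|h h_inj] := @injection_ord ('I_t * F)%type n.
  by rewrite card_prod card_ord cardF.
have le_tF : t <= #|F| by rewrite cardF.
pose g (x : 'I_t) : F := enum_val (widen_ord le_tF x).
have g_inj : injective g by move=> x y /enum_val_inj [] /val_inj.
pose b (p : F * F) := [set h (x, p.1 * g x + p.2)%R | x : 'I_t].
have card_b p : #|b p| = t by rewrite card_imset ?card_ord // => x y /h_inj[].
have lin p q x y : x != y -> x \in b p -> y \in b p -> x \in b q -> y \in b q ->
    p = q.
  move=> xy /imsetP[x1 _ ex] /imsetP[y1 _ ey] /imsetP[x2 _].
  rewrite ex => /h_inj[<- eqx] /imsetP[y2 _]; rewrite ey => /h_inj[<- eqy].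
  (* Distinct points of the graph of a function have distinct abscissae, so agreement at both forces
     equal slopes. *)
  have xy1 : (g x1 - g y1 != 0)%R.
    by rewrite subr_eq0; apply: contra xy => /eqP/g_inj xy1; rewrite ex ey xy1.
  have e1 : p.1 = q.1.
    apply/eqP; rewrite -subr_eq0 -(mulIr_eq0 _ (mulIf xy1)); apply/eqP.
    transitivity (p.1 * g x1 + p.2 - (q.1 * g x1 + q.2) -
                  (p.1 * g y1 + p.2 - (q.1 * g y1 + q.2)))%R; first by ring.
    by rewrite eqx eqy !subrr.
  have e2 : p.2 = q.2 by move: eqx; rewrite e1 => /addrI.
  by rewrite (surjective_pairing p) e1 e2 -surjective_pairing.
have := @extremal_ge 4 n (St4 s k) _ (uniform_block_edges b).
have le_b i : #|b i| <= (2 * k).+1 by rewrite card_b leqnSn.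
move=> /(_ (linear_space_St4_free s0 (ltnW k1) le_b lin)).
rewrite (card_block_edges card_b) => [|p q pq]; last first.
  rewrite ltnNge; apply/negP=> ge4.
  have /card_gt1P[x [y [xI yI xy]]] : 1 < #|b p :&: b q| by apply: leq_trans ge4.
  move: xI yI; rewrite !inE => /andP[xp xq] /andP[yp yq].
  by rewrite (lin _ _ _ _ xy xp yp xq yq) eqxx in pq.
rewrite card_prod cardF => leE.
apply: leq_trans (leq_mul (leqnn 64) (leq_mul (leqnn 4`!) leE)).
by rewrite (mulnCA 4`!) mulnCA leq_mul2l expn4_le_bin ?orbT //; rewrite /t; lia.
Qed.

(** * The order of magnitude *)

(** With [m <= 3 s k] and [N <= 5 s k], the factors are [16 = 2 * 3 + 2 * 5] and
    [29 = 3 * 3 + 4 * 5]. *)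
Lemma extremal_St4_le n s k : 0 < s -> 0 < k ->
  extremal 4 n (St4 s k) <=
    8 * (n * k) ^ 2 + 3 * 16 * 29 * (n * (s * k) ^ 3) + 6 * ((n * s) ^ 2 * k).
Proof.
move=> s0 k0; apply/bigmax_leqP=> E /andP[uE nocopy].
apply: leq_trans (St4_free_card uE k0 nocopy) _; rewrite card_ord.
have lem : s * (2 * k).+1 <= 3 * (s * k) by nia.
have leN : s + s * (2 * k).+1 + k <= 5 * (s * k) by nia.
move: (s * (2 * k).+1) (_ + k) lem leN => m N lem leN.
have le1 : 2 * m + 2 * N <= 16 * (s * k) by lia.
have le2 : 3 * m + 4 * N <= 29 * (s * k) by lia.
apply: leq_add; first apply: leq_add.
- by rewrite !expnS expn0; lia.
- apply: leq_trans (leq_mul (leqnn n) (leq_mul lem (leq_mul le1 le2))) _.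
  by rewrite !expnS expn0; lia.
- apply: leq_trans (leq_mul (leqnn n) (leq_mul lem (leqnn _))) _.
  by rewrite !expnS expn0; lia.
Qed.

(** The field order [2 ^ j] is the largest power of two at most [n %/ (2 * k)]. Rounding loses a
    factor below 2, and [8 k ^ 2 <= n] leaves room for [2 k] abscissae. *)
Lemma extremal_St4_ge_sq n s k : 0 < s -> 1 < k -> 8 * k ^ 2 <= n ->
  (n * k) ^ 2 <= 64 * (4`! * extremal 4 n (St4 s k)).
Proof.
move=> s0 k1 kn; set d := n %/ (2 * k); set j := trunc_log 2 d.
have k2_gt0 : 0 < 2 * k by lia.
have ge_d : 4 * k <= d.
  by rewrite leq_divRL //; apply: leq_trans kn; rewrite !expnS expn0; lia.
have /andP[le_qd lt_dq] : 2 ^ j <= d < 2 ^ j.+1 by apply: trunc_log_bounds => //; lia.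
rewrite expnS in lt_dq.
have j0 : 0 < j by case: j lt_dq {le_qd} => //; rewrite expn0; lia.
have kq : 2 * k <= 2 ^ j by lia.
have qn : 2 * k * 2 ^ j <= n.
  by rewrite mulnC; apply: leq_trans (leq_divM n (2 * k)); rewrite leq_mul2r le_qd orbT.
apply: leq_trans (extremal_ge_lines s0 k1 j0 kq qn).
have nq : n <= 2 * k * (2 * 2 ^ j) by rewrite mulnC; apply: ltnW; rewrite -ltn_divLR.
have -> : (2 ^ j) ^ 2 * (2 * k) ^ 4 = (2 * k * (2 * 2 ^ j) * k) ^ 2.
  by move: (2 ^ j) => q; rewrite !expnS expn0; lia.
by rewrite leq_exp2r // leq_mul2r nq orbT.
Qed.

(** Cliques have one vertex fewer than the star, or [n] vertices if that is less. The factor 2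
    absorbs the vertices left over after division by [t]. *)
Lemma extremal_St4_ge_cube n s k (t := minn n (s * (2 * k).+1)) :
  0 < s -> 1 < k -> 4 <= n ->
  n * t ^ 3 <= 2 * (64 * (4`! * extremal 4 n (St4 s k))).
Proof.
move=> s0 k1 n4.
have t4 : 4 <= t by rewrite leq_min n4 /=; nia.
have tsk : t <= s * (2 * k).+1 by exact: geq_minr.
have tn : t <= n by exact: geq_minl.
apply: leq_trans (leq_mul (leqnn 2) (extremal_ge_cliques n s0 (ltnW k1) t4 tsk)).
have t0 : 0 < t by lia.
have d0 : 0 < n %/ t by rewrite divn_gt0.
have nt : n <= 2 * (n %/ t * t).
  by have := ltn_pmod n t0; rewrite {2}(divn_eq n t); nia.
have -> : 2 * (n %/ t * t ^ 4) = 2 * (n %/ t * t) * t ^ 3 by rewrite !expnS; lia.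
by rewrite leq_mul2r nt orbT.
Qed.

Local Open Scope ring_scope.

Lemma powR_half_nat (R : realType) (k : R) (m : nat) : 0 <= k ->
  k `^ (m%:R / 2) = Num.sqrt k ^+ m.
Proof.
by move=> k0; rewrite mulrC powRrM powR12_sqrt // powR_mulrn // sqrtr_ge0.
Qed.

Theorem theorem4p3 (R : realType) :
  exists c C : R, 0 < c /\ 0 < C /\
    forall n k s : nat,
      (4 <= n)%N ->
      (2 <= k)%N -> k%:R <= n%:R `^ (2 / 3) :> R ->
      is_rounding s (Num.sqrt (k%:R : R)) ->
      let M : R := Num.max (k%:R ^+ 2 * n%:R ^+ 2) (k%:R `^ (9 / 2) * n%:R) in
      c * M <= (extremal 4 n (gen_star s [:: k; 1%N]))%:R
      /\ (extremal 4 n (gen_star s [:: k; 1%N]))%:R <= C * M.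
Proof.
(* Below: [64 * 24] from counting 4-sets, 2 from dividing [n] into cliques, 8 from the range
   [n < 8 k ^ 2]. Above: [32 = 8 + 6 * 4], where 4 and the final 8 are the square and cube of the
   bound 2 on [s / r]. *)
exists ((8 * (2 * (64 * 24)))^-1), (32 + 3 * 16 * 29 * 8); split; first by [].
split; first by lra.
move=> n k s n4 k2 kn sr M; rewrite {}/is_rounding in sr.
set x : R := n%:R in kn M *; set r := Num.sqrt _ in sr.
set e : R := (extremal _ _ _)%:R.
have x0 : 0 <= x by exact: ler0n.
have e0 : 0 <= e by exact: ler0n.
have r2 : r ^+ 2 = k%:R by rewrite sqr_sqrtr.
have r1 : 1 < r.
  by rewrite -sqrtr1 ltr_sqrt ?ltr1n ?ltr0n // (leq_trans _ k2).
have k92 : k%:R `^ (9 / 2) = r ^+ 9 :> R by rewrite powR_half_nat.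
(* The hypothesis [k <= n ^ (2/3)] in the form that cliques of order [k ^ (3/2)] fit into [n]
   vertices. *)
have r3x : r ^+ 3 <= x.
  have := ge0_ler_powR (_ : 0 <= 3%:R / 2 :> R) _ _ kn.
  rewrite !nnegrE powR_half_nat // -powRrM.
  rewrite (_ : 2 / 3 * (3%:R / 2) = 1) ?powRr1 //; last by field.
  by apply; rewrite ?divr_ge0 ?powR_ge0.
have [s_gt s_lt] : r - 1 < s%:R /\ s%:R < r + 1.
  by move: sr; rewrite ltr_norml => /andP[]; split; lra.
have s0 : (0 < s)%N by rewrite -(ltr0n R); lra.
have s1 : 1 <= s%:R :> R by rewrite ler1n.
have le_s : s%:R <= 2 * r by lra.
have ge_s : r <= 2 * s%:R by lra.
have k0 : (0 < k)%N by exact: ltnW.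
have ME : M = Num.max (r ^+ 4 * x ^+ 2) (r ^+ 9 * x).
  by rewrite /M k92 -r2 -exprM.
have Mx2 : r ^+ 4 * x ^+ 2 <= M by rewrite ME le_max lexx.
have Mx : r ^+ 9 * x <= M by rewrite ME le_max lexx orbT.
split.
  rewrite mulrC ler_pdivrMr; last by lra.
  set t := minn n (s * (2 * k).+1).
  (* If the minimum is [n], this is [r3x]; otherwise [s >= r / 2] and [2 k + 1 > 2 r ^ 2]. *)
  have t_ge : r ^+ 3 <= t%:R.
    rewrite /t /minn; case: ifP => // _.
    rewrite natrM mulrS natrM -r2.
    have : r * (2 * r ^+ 2) <= 2 * s%:R * (1 + 2 * r ^+ 2).
      by apply: ler_pM; nra.
    by rewrite exprS; lra.
  have cube : r ^+ 9 * x <= 2 * (64 * (24 * e)).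
    have := extremal_St4_ge_cube s0 k2 n4; rewrite -/t -(ler_nat R) !(natrM, natrX).
    rewrite -/x -/e => /(le_trans _); apply.
    rewrite mulrC ler_wpM2l // -[9%N]/(3 * 3)%N exprM.
    by rewrite lerXn2r ?nnegrE ?exprn_ge0 //; lra.
  rewrite ME ge_max; apply/andP; split; last by lra.
  have [nk|nk] := leqP (8 * k ^ 2) n.
    have := extremal_St4_ge_sq s0 k2 nk; rewrite -(ler_nat R) !(natrM, natrX).
    by rewrite -/x -/e exprMn -r2 -exprM mulrC => sq; lra.
  (* In the range [n < 8 k ^ 2] the clique bound dominates: [x <= 8 r ^ 4 <= 8 r ^ 5] bounds the
     square term by 8 times the other. *)
  have xr : x <= 8 * r ^+ 4.
    by rewrite -[4%N]/(2 * 2)%N exprM r2 -natrX -natrM ler_nat ltnW.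
  have xr5 : x <= 8 * r ^+ 5.
    apply: le_trans xr _; rewrite ler_wpM2l // [leRHS]exprS.
    by rewrite ler_peMl ?exprn_ge0 //; lra.
  have : r ^+ 4 * x ^+ 2 <= 8 * (r ^+ 9 * x).
    have -> : r ^+ 4 * x ^+ 2 = (r ^+ 4 * x) * x by ring.
    have -> : 8 * (r ^+ 9 * x) = (r ^+ 4 * x) * (8 * r ^+ 5) by ring.
    by rewrite ler_wpM2l // mulr_ge0 // exprn_ge0 //; lra.
  lra.
have := extremal_St4_le n s0 k0.
rewrite -(ler_nat R) !(natrD, natrM, natrX) -/x -/e -r2 => /le_trans; apply.
have sr3 : x * (s%:R * r ^+ 2) ^+ 3 <= 8 * (r ^+ 9 * x).
  have -> : 8 * (r ^+ 9 * x) = x * (2 * r * r ^+ 2) ^+ 3 by ring.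
  rewrite ler_wpM2l // lerXn2r ?nnegrE ?mulr_ge0 ?exprn_ge0 //; try lra.
  by rewrite ler_wpM2r ?exprn_ge0 //; lra.
have sr2 : (x * s%:R) ^+ 2 * r ^+ 2 <= 4 * (r ^+ 4 * x ^+ 2).
  have -> : 4 * (r ^+ 4 * x ^+ 2) = (x * (2 * r)) ^+ 2 * r ^+ 2 by ring.
  rewrite ler_wpM2r ?exprn_ge0 //; first lra.
  rewrite lerXn2r ?nnegrE ?mulr_ge0 //; try lra.
  by rewrite ler_wpM2l.
have -> : (x * r ^+ 2) ^+ 2 = r ^+ 4 * x ^+ 2 by ring.
lra.
Qed.
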